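(* Let $m\ge1$ and for all $k\in\mathbb{Z}$ put $\Phi_k(x,\underline a)=\Phi_0(\omega^kx,\omega^k.\underline a)$. Then for every $k\in\mathbb{Z}$: (1) $\Phi_k(x,\underline a)$ is analytic in $x$ on the universal covering of $\mathbb{C}^\star$ and entire in $\underline a$. (2) $\{\Phi_k,\Phi_{k+1}\}$ is a fundamental system of solutions of $(\mathfrak{E}_m)$. (3) We have $$\begin{pmatrix}\Phi_{k-1}\\ \Phi_k\end{pmatrix}(x,\underline a)=\mathfrak{S}_k(\underline a)\begin{pmatrix}\Phi_k\\ \Phi_{k+1}\end{pmatrix}(x,\underline a),\qquad \mathfrak{S}_k(\underline a)=\begin{pmatrix}C_k(\underline a)&\widetilde C_k(\underline a)\\1&0\end{pmatrix},$$ where the Stokes-Sibuya connection matrix $\mathfrak{S}_k(\underline a)$ is invertible and entire in $\underline a$. Moreover $\mathfrak{S}_k(\underline a)=\mathfrak{S}_{k-1}(\omega.\underline a)$ and $\mathfrak{S}_k(\underline a)=\mathfrak{S}_0(\omega^k.\underline a)$. (4) The Stokes-Sibuya coefficients $C_k(\underline a)$ and $\widetilde C_k(\underline a)$ are entire functions of $\underline a$, and $$C_k(\underline a)=C_0(\omega^k.\underline a),\quad C_k=C_{k\bmod m},\qquad \widetilde C_k(\underline a)=\widetilde C_0(\omega^k.\underline a)=\omega^{m-2+2r(\omega^k.\underline a)},\quad \widetilde C_k=\widetilde C_{k\bmod m}.$$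
   Context: $(\mathfrak{E}_m)$ is the equation $\Phi''(x)=\frac{P_m(x,\underline a)}{x^2}\Phi(x)$ with $P_m(x,\underline a)=x^m+a_1x^{m-1}+\cdots+a_m$, $\underline a\in\mathbb{C}^m$; $x$ lies on the universal covering of $\mathbb{C}^\star$, with $\arg x\in\mathbb{R}$. Fix a sign and put $\omega=e^{\pm2i\pi/m}$; $\omega^c:=\exp(\pm2i\pi c/m)$, and $\omega^kx$ has argument $\arg x\pm2\pi k/m$. For $\lambda\in\mathbb{C}$, $\lambda.\underline a:=(\lambda a_1,\dots,\lambda^ma_m)$. Define $b_{\frac m2-k}(\underline a)$ by the expansion at infinity $\frac{\sqrt{P_m(x,\underline a)}}{x}=x^{\frac m2-1}+\sum_{k\ge1}b_{\frac m2-k}(\underline a)x^{\frac m2-k-1}$. Set $r(\underline a)=\frac12-\frac m4$ if $m$ is odd, $r(\underline a)=\frac12-\frac m4-b_0(\underline a)$ if $m$ is even, and $S(x,\underline a)=\frac2mx^{\frac m2}+\sum_{1\le k<m/2}\frac{b_{\frac m2-k}(\underline a)}{\frac m2-k}x^{\frac m2-k}$. Then $\Phi_0(x,\underline a)$ denotes the unique solution of $(\mathfrak{E}_m)$ which, in every strict sub-sector of $\Sigma_0=\{|\arg x|<3\pi/m\}$, is asymptotic at infinity to $x^{r(\underline a)}e^{-S(x,\underline a)}\phi_0$, $\phi_0$ a formal series in $x^{-1/2}$ with constant term $1$ (in $x^{-1}$ for $m$ even), locally uniformly in $\underline a$; it extends analytically to the universal covering of $\mathbb{C}^\star$ and is entire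 in $\underline a$. The Stokes-Sibuya coefficients $C_k,\widetilde C_k$ are the functions of $\underline a$ defined by $\Phi_{k-1}=C_k(\underline a)\Phi_k+\widetilde C_k(\underline a)\Phi_{k+1}$. *)

(* Defs.v *)
From HB Require Import structures.
From mathcomp Require Import all_boot all_order all_algebra.
From mathcomp Require Import all_classical all_reals all_analysis.
From mathcomp Require Import complex.

Set Implicit Arguments.
Unset Strict Implicit.
Unset Printing Implicit Defensive.

Import Order.TTheory GRing.Theory Num.Theory.
Import numFieldNormedType.Exports.

Local Open Scope classical_set_scope.
Local Open Scope ring_scope.

(* R[i], packed as a numClosedFieldType so that the norm topology on the field
   itself and on row vectors and matrices over it is found by inference;
   [derivable] and [differentiable] below are therefore C-differentiability. *)
Definition cplx (R : realType) : numClosedFieldType := R[i]%C.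

Section Complex.
Context {R : realType}.

Definition ofReal (x : R) : cplx R := (x%:C)%C.

Definition cexp (z : cplx R) : cplx R :=
  ofReal (expR (complex.Re z)) *
  Complex (cos (complex.Im z)) (sin (complex.Im z)).

(* The universal covering of C^* is modelled as cexp : C -> C^*.  A point t of
   the covering lies above cexp t, has modulus expR (Re t) and argument Im t;
   the function x |-> x ^ c on the covering is single valued. *)
Definition modulus (t : cplx R) : R := expR (complex.Re t).
Definition arg (t : cplx R) : R := complex.Im t.
Definition cover_pow (t c : cplx R) : cplx R := cexp (c * t).

Definition analytic_on_cover (f : cplx R -> cplx R) : Prop :=
  forall t, derivable f t 1.

(* x = cexp t, hence d/dx = (1 / x) d/dt *)
Definition Dx (f : cplx R -> cplx R) (t : cplx R) : cplx R :=
  (f^`()%classic t) / cexp t.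

Definition entire (V W : normedModType (cplx R)) (f : V -> W) : Prop :=
  forall a, differentiable f a.

End Complex.

Section SqrtSeries.
Context {K : numFieldType}.

Fixpoint sqrt_seq (p : nat -> K) (n : nat) : seq K :=
  if n is n'.+1 then
    let s := sqrt_seq p n' in
    rcons s ((p n - \sum_(1 <= i < n) s`_i * s`_(n - i)) / 2)
  else [:: 1].

(* The coefficients of the formal power series with constant term 1 whose
   square is \sum_k p k u^k, when p 0 = 1: see the two lemmas below. *)
Definition sqrt_coef (p : nat -> K) (k : nat) : K := (sqrt_seq p k)`_k.

Lemma size_sqrt_seq p n : size (sqrt_seq p n) = n.+1.
Proof. by elim: n => //= n IH; rewrite size_rcons IH. Qed.

Lemma nth_sqrt_seq p n i : (i <= n)%N -> (sqrt_seq p n)`_i = sqrt_coef p i.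
Proof.
elim: n => [|n IH]; first by rewrite leqn0 => /eqP->.
rewrite leq_eqVlt ltnS => /orP[/eqP-> //|lein] /=.
by rewrite nth_rcons size_sqrt_seq ltnS lein IH.
Qed.

Lemma sqrt_coefS p n : sqrt_coef p n.+1 =
  (p n.+1 - \sum_(1 <= i < n.+1) sqrt_coef p i * sqrt_coef p (n.+1 - i)) / 2.
Proof.
rewrite {1}/sqrt_coef /= nth_rcons size_sqrt_seq ltnn eqxx.
congr ((_ - _) / _); apply: eq_big_nat => i /andP[i1 ilt].
by case: i i1 ilt => // i _ ilt; rewrite !nth_sqrt_seq// subSS leq_subr.
Qed.

Lemma conv_ends (b : nat -> K) n : \sum_(0 <= i < n.+2) b i * b (n.+1 - i)%N =
  b 0%N * b n.+1 *+ 2 + \sum_(1 <= i < n.+1) b i * b (n.+1 - i)%N.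
Proof.
rewrite big_nat_recr//= big_ltn// subn0 subnn (mulrC (b n.+1)) addrAC.
by rewrite -mulr2n.
Qed.

Lemma sqrt_coef_sqr p n : p 0%N = 1 ->
  \sum_(0 <= i < n.+1) sqrt_coef p i * sqrt_coef p (n - i) = p n.
Proof.
move=> p0; case: n => [|n]; first by rewrite big_nat1 p0 mulr1.
rewrite conv_ends mul1r sqrt_coefS -mulr_natr divfK ?pnatr_eq0//.
by rewrite subrK.
Qed.

Lemma sqrt_coef_uniq p (b : nat -> K) : b 0%N = 1 ->
    (forall n, \sum_(0 <= i < n.+1) b i * b (n - i)%N = p n) ->
  forall n, b n = sqrt_coef p n.
Proof.
move=> b0 bP n; elim/ltn_ind: n => -[_|n IH]; first by rewrite b0.
rewrite sqrt_coefS -(bP n.+1) conv_ends b0 mul1r.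
under [X in _ - X]eq_big_nat => i /andP[i1 ilt].
  rewrite -!IH//; last by case: i i1 {ilt} => // i _; rewrite subSS ltnS leq_subr.
  over.
by rewrite addrK -mulr_natr mulfK// pnatr_eq0.
Qed.

End SqrtSeries.

Section Equation.
Context {R : realType} {m : nat}.
Implicit Types (a : 'rV[cplx R]_m) (t : cplx R).

(* The parameter a_i of the mathematics is a 0 (i - 1). *)
Definition Pm a : {poly cplx R} :=
  'X^m + \sum_(i < m) a ord0 i *: 'X^(m - i.+1).

Definition dilate (lambda : cplx R) a : 'rV[cplx R]_m :=
  \row_(i < m) (lambda ^+ i.+1 * a ord0 i).

Definition is_solution a (f : cplx R -> cplx R) : Prop :=
  [/\ analytic_on_cover f, analytic_on_cover (Dx f) &
      forall t, Dx (Dx f) t = (Pm a).[cexp t] / cexp t ^+ 2 * f t].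

Definition fundamental_system a (f g : cplx R -> cplx R) : Prop :=
  [/\ is_solution a f, is_solution a g,
      (forall c d : cplx R, (forall t, c * f t + d * g t = 0) ->
         c = 0 /\ d = 0) &
      (forall h, is_solution a h ->
         exists c d : cplx R, forall t, h t = c * f t + d * g t)].

(* b_coef a k is b_{m/2 - k}(a): with u = 1 / x, P_m(x, a) = x^m \sum_k p_k u^k
   where p_k is the coefficient of x^(m - k), so that
   sqrt(P_m(x, a)) / x = x^(m/2 - 1) \sum_k (b_coef a k) u^k. *)
Definition b_coef a : nat -> cplx R :=
  sqrt_coef (fun k => if (k <= m)%N then (Pm a)`_(m - k) else 0).

Definition r_exp a : cplx R :=
  if odd m then 1 / 2 - m%:R / 4 else 1 / 2 - m%:R / 4 - b_coef a m./2.

Definition S_fun t a : cplx R :=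
  2 / m%:R * cover_pow t (m%:R / 2) +
  \sum_(1 <= k < m | (k.*2 < m)%N)
    b_coef a k / (m%:R / 2 - k%:R) * cover_pow t (m%:R / 2 - k%:R).

(* f ~ x^r e^{-S} \sum_n (c n) x^{-n/2} (Poincare asymptotics to all orders) in
   every strict sub-sector of |arg x| < 3 pi / m, locally uniformly in a. *)
Definition asymptotic_in_Sigma0 (f : cplx R -> 'rV[cplx R]_m -> cplx R)
    (c : nat -> 'rV[cplx R]_m -> cplx R) : Prop :=
  forall (alpha beta : R) (N : nat) (a0 : 'rV[cplx R]_m),
    - (3 * pi / m%:R) < alpha -> beta < 3 * pi / m%:R ->
  exists K rho : R, \forall a \near a0, forall t,
    alpha <= arg t <= beta -> rho <= modulus t ->
    `|f t a / (cover_pow t (r_exp a) * cexp (- S_fun t a))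
       - \sum_(n < N) c n a * cover_pow t (- (n%:R / 2))|
      <= ofReal (K * modulus t `^ (- (N%:R / 2))).

Record is_Phi0 (Phi0 : cplx R -> 'rV[cplx R]_m -> cplx R) : Prop := {
  Phi0_solution : forall a, is_solution a (Phi0 ^~ a);
  Phi0_asymptotic : exists c : nat -> 'rV[cplx R]_m -> cplx R,
    [/\ forall a, c 0%N a = 1,
        ~~ odd m -> forall n a, odd n -> c n a = 0 &
        asymptotic_in_Sigma0 Phi0 c];
  Phi0_entire : forall t, entire (Phi0 t) }.

End Equation.

Section Rotation.
Context {R : realType}.

(* omega = exp(+- 2 i pi / m), the sign being (-1) ^+ s.  On the covering,
   multiplication by omega^c is the translation by omega_log s m c. *)
Definition omega_log (s : bool) (m : nat) (c : cplx R) : cplx R :=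
  (-1) ^+ s * (Complex 0 (2 * pi) * c / m%:R).
Definition omega_pow (s : bool) (m : nat) (c : cplx R) : cplx R :=
  cexp (omega_log s m c).

Definition Phi_ (s : bool) (m : nat)
    (Phi0 : cplx R -> 'rV[cplx R]_m -> cplx R) (k : int)
    (t : cplx R) (a : 'rV[cplx R]_m) : cplx R :=
  Phi0 (t + omega_log s m k%:~R) (dilate (omega_pow s m k%:~R) a).

(* The relation Phi_{k-1} = C_k Phi_k + C~_k Phi_{k+1}, for functions of x at
   each fixed a, determines C_k(a) and C~_k(a). *)
Definition stokes_sibuya_coefficients (m : nat)
    (Phi : int -> cplx R -> 'rV[cplx R]_m -> cplx R)
    (C Ct : int -> 'rV[cplx R]_m -> cplx R) : Prop :=
  forall k a (c ct : cplx R),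
    (forall t, Phi (k - 1) t a = c * Phi k t a + ct * Phi (k + 1) t a) <->
    (c = C k a /\ ct = Ct k a).

Definition col2 (u v : cplx R) : 'cV[cplx R]_2 :=
  \col_(i < 2) (if i == ord0 then u else v).

Definition stokes_matrix (m : nat) (C Ct : int -> 'rV[cplx R]_m -> cplx R)
    (k : int) (a : 'rV[cplx R]_m) : 'M[cplx R]_2 :=
  \matrix_(i < 2, j < 2)
    (if i == ord0 then (if j == ord0 then C k a else Ct k a)
     else (if j == ord0 then 1 else 0)).

End Rotation.

(* Main.v *)
Require Import Defs.
From mathcomp Require Import all_boot all_order all_algebra.
From mathcomp Require Import all_classical all_reals all_analysis.
From mathcomp Require Import complex zify ring lra.
Import numFieldNormedType.Exports.
Import Order.TTheory GRing.Theory Num.Theory.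

(** Everything takes place on the ray [arg x = 0].  Put [Phi_0 ~ x^r e^(-S)] there.
    The rotation by [omega] changes [S] into [- S], because [omega^(m/2) = -1] and
    [b_k] is homogeneous of weight [k] in the parameters ([S_fun_rotate]), and
    changes [r] into [1 - m/2 - r] ([r_exp_rotate]).  The ray lies in the sectors of
    validity of the three expansions of [Phi_{-1}], [Phi_0] and [Phi_1], so there
    [Phi_0] is exponentially small with respect to [Phi_1] and [Phi_{-1}], which are
    both equivalent to constants times [x^(1 - m/2 - r) e^S].

    Two facts follow.  First, [Phi_0] and [Phi_1] form a fundamental system
    ([recessive_fundamental]): their Wronskian is a constant, and if it vanished the
    quotient [Phi_0 / Phi_1] would be constant on the ray, hence [0]; once the
    Wronskian is nonzero, Cramer's rule expresses any solution, without recourse to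
    an existence and uniqueness theorem.  Second, in the relation
    [Phi_{-1} = C_0 Phi_0 + Ct_0 Phi_1] the coefficient [Ct_0] is the limit of
    [Phi_{-1} / Phi_1], that is [omega^(m - 2 + 2 r)] ([cvg_PhiN1],
    [stokes_relation0]).

    That [Ct_0] is entire is clear from its closed form.  As to [C_0], it is the
    quotient [(Phi_{-1} - Ct_0 Phi_1) / Phi_0] taken at any point where [Phi_0] does
    not vanish ([entire_stokes0]); this avoids the derivatives in [x] that a formula
    by Wronskians would involve, whose dependence on the parameters would have to be
    studied.

    The substitution [(x, a) -> (omega^k x, omega^k.a)] preserves the equation
    ([is_solution_rotate]) and shifts the indices by [k] ([Phi_shift]), which gives
    the general case and the symmetries of the coefficients; periodicity in [k] is
    [omega^m = 1]. *)

Set Implicit Arguments.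
Unset Strict Implicit.
Unset Printing Implicit Defensive.

Local Open Scope classical_set_scope.
Local Open Scope ring_scope.

(** * Complex numbers over the reals *)

Section ComplexNumbers.
Context {R : realType}.
Implicit Types (x y : R) (z w t : cplx R).

Lemma ofRealD x y : ofReal (x + y) = ofReal x + ofReal y.
Proof. exact: rmorphD. Qed.

Lemma ofRealB x y : ofReal (x - y) = ofReal x - ofReal y.
Proof. exact: rmorphB. Qed.

Lemma ofRealM x y : ofReal (x * y) = ofReal x * ofReal y.
Proof. exact: rmorphM. Qed.

Lemma ofRealV x : ofReal x^-1 = (ofReal x)^-1.
Proof. exact: fmorphV. Qed.

Lemma ofReal_nat n : ofReal n%:R = n%:R :> cplx R.
Proof. exact: rmorph_nat. Qed.

Lemma ofReal0 : ofReal 0 = 0 :> cplx R. Proof. by []. Qed.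

Lemma ofReal1 : ofReal 1 = 1 :> cplx R. Proof. by []. Qed.

Lemma ofReal_eq0 x : (ofReal x == 0) = (x == 0).
Proof. exact: fmorph_eq0. Qed.

Lemma ler_ofReal x y : (ofReal x <= ofReal y) = (x <= y).
Proof. exact: lecR. Qed.

Lemma ltr_ofReal x y : (ofReal x < ofReal y) = (x < y).
Proof. exact: ltcR. Qed.

Lemma normCE z :
  `|z| = ofReal (Num.sqrt (complex.Re z ^+ 2 + complex.Im z ^+ 2)).
Proof. exact: normc_def. Qed.

Lemma norm_ofReal x : `|ofReal x| = ofReal `|x|.
Proof. by rewrite normCE /= expr0n /= addr0 sqrtr_sqr. Qed.

Lemma pos_ofReal z : 0 < z -> exists2 e : R, 0 < e & z = ofReal e.
Proof.
move=> z0; have /RRe_real zE : z \is Num.real by rewrite gtr0_real.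
by exists (complex.Re z) => //; rewrite -ltr_ofReal /ofReal zE.
Qed.

Lemma ReD z w : complex.Re (z + w) = complex.Re z + complex.Re w.
Proof. by case: z; case: w. Qed.

Lemma ReN z : complex.Re (- z) = - complex.Re z.
Proof. by case: z. Qed.

Lemma ReM_ofReal z x : complex.Re (z * ofReal x) = complex.Re z * x.
Proof. by case: z => a b /=; rewrite mulr0 subr0. Qed.

Lemma Re_norm_le z : ofReal `|complex.Re z| <= `|z|.
Proof. exact: normc_ge_Re. Qed.

Lemma cplxE z : z = ofReal (complex.Re z) + Complex 0 1 * ofReal (complex.Im z).
Proof. exact: complexE. Qed.

Lemma norm_i : `|Complex 0 1 : cplx R| = 1.
Proof. by rewrite normCE /= expr0n expr1n add0r sqrtr1. Qed.

Lemma Im_norm_le z : ofReal `|complex.Im z| <= `|z|.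
Proof.
have -> : complex.Im z = complex.Re (- Complex 0 1 * z).
  by case: z => a b /=; ring.
by apply: le_trans (Re_norm_le _) _; rewrite normrM normrN norm_i mul1r.
Qed.

Lemma continuous_Re : continuous (@complex.Re R : cplx R -> R).
Proof.
move=> z; apply: (proj2 (@cvgrPdist_lt _ _ _ (nbhs z) _ _ _)) => e e0.
have e0' : 0 < ofReal e by rewrite ltr_ofReal.
have := nbhsx_ballx z (ofReal e) e0'; apply: filterS => w zw.
by rewrite -ltr_ofReal (le_lt_trans _ zw)// -ReN -ReD Re_norm_le.
Qed.

Lemma continuous_Im : continuous (@complex.Im R : cplx R -> R).
Proof.
move=> z; apply: (proj2 (@cvgrPdist_lt _ _ _ (nbhs z) _ _ _)) => e e0.
have e0' : 0 < ofReal e by rewrite ltr_ofReal.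
have := nbhsx_ballx z (ofReal e) e0'; apply: filterS => w zw.
rewrite -ltr_ofReal (le_lt_trans _ zw)//.
by have := Im_norm_le (z - w); case: (z) => ? ?; case: (w).
Qed.

Lemma continuous_ofReal : continuous (@ofReal R).
Proof.
move=> x; apply: (proj2 (@cvgrPdist_lt _ _ _ (nbhs x) _ _ _)).
move=> e /pos_ofReal[d d0 ->].
have := nbhsx_ballx x d d0; apply: filterS => y xy.
by rewrite -ofRealB norm_ofReal ltr_ofReal.
Qed.

End ComplexNumbers.

(** * The complex exponential and complex derivatives along segments *)

Section DifferenceQuotient.
Context {K : numFieldType}.
Implicit Types (f : K -> K) (t d e : K).

(** These two lemmas trade derivatives for first-order Taylor estimates, the
    only form in which a derivative over the reals can be compared with one over
    the complex numbers. *)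
Lemma is_derive_near f t d e : 0 < e -> is_derive t 1 f d ->
  \forall k \near 0, `|f (k + t) - f t - d * k| <= e * `|k|.
Proof.
move=> e0 [/cvg_ex[l fl] dE].
have lE : l = d by rewrite -dE; apply/esym/cvg_lim.
move: fl; rewrite lE => /cvgrPdist_lt /(_ e e0)/nbhs_ballP[r r0 H].
apply/nbhs_ballP; exists r => // k kr.
have [->|k0] := eqVneq k 0.
  by rewrite add0r subrr mulr0 subr0 normr0 mulr0.
have /ltW := H k kr k0; rewrite /=.
rewrite -(ler_pM2r (_ : 0 < `|k|)) ?normr_gt0// -normrM distrC.
by rewrite scaler1 mulrBl [_ *: _ * k]mulrAC mulVf// mul1r.
Qed.

Lemma near_is_derive f t d :
    (forall e, 0 < e -> \forall k \near 0, `|f (k + t) - f t - d * k| <= e * `|k|) ->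
  is_derive t 1 f d.
Proof.
move=> H; have fd : (fun h : K => h^-1 *: ((f \o shift t) (h *: 1) - f t)) @ 0^' --> d.
  apply/cvgrPdist_lt => e e0.
  have /nbhs_ballP[r r0 Hr] := H (e / 2) (divr_gt0 e0 (ltr0Sn K 1)).
  apply/nbhs_ballP; exists r => // k kr k0 /=.
  rewrite scaler1.
  have := Hr k kr.
  rewrite -(ltr_pM2r (_ : 0 < `|k|)) ?normr_gt0// -normrM distrC.
  rewrite mulrBl [_ *: _ * k]mulrAC mulVf// mul1r => /le_lt_trans; apply.
  by rewrite ltr_pM2r ?normr_gt0// ltr_pdivrMr// ltr_pMr// ltr1n.
split; first by apply/cvg_ex; exists d.
exact/cvg_lim.
Qed.

Lemma is_derive_mul f g t df dg : is_derive t 1 f df -> is_derive t 1 g dg ->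
  is_derive t 1 (fun z => f z * g z) (df * g t + f t * dg).
Proof.
move=> fd gd; apply: is_derive_eq (is_deriveM fd gd) _.
by rewrite addrC [df * _]mulrC.
Qed.

Lemma is_derive_sub f g t df dg : is_derive t 1 f df -> is_derive t 1 g dg ->
  is_derive t 1 (fun z => f z - g z) (df - dg).
Proof. by move=> fd gd; exact: is_deriveB fd gd. Qed.

Lemma is_derive_inv f t d : f t != 0 -> is_derive t 1 f d ->
  is_derive t 1 (fun z => (f z)^-1) (- d / f t ^+ 2).
Proof.
move=> ft fd; split; first exact: derivableV.
by rewrite deriveV// derive_val [RHS]mulrC mulrN -mulNr.
Qed.

End DifferenceQuotient.

Section ComplexExponential.
Context {R : realType}.
Implicit Types (x y : R) (z w t : cplx R).

Lemma cexpD z w : cexp (z + w) = cexp z * cexp w.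
Proof.
case: z => a b; case: w => c d; rewrite /cexp /= expRD cosD sinD.
apply/eqP; rewrite eq_complex /=; apply/andP; split; apply/eqP; ring.
Qed.

Lemma cexp0 : cexp 0 = 1 :> cplx R.
Proof. by rewrite /cexp /= expR0 cos0 sin0 mul1r. Qed.

Lemma cexpMn z n : cexp (z *+ n) = cexp z ^+ n.
Proof. by elim: n => [|n IH]; rewrite ?cexp0// mulrS cexpD IH exprS. Qed.

Lemma norm_cexp z : `|cexp z| = ofReal (expR (complex.Re z)).
Proof.
rewrite /cexp normrM norm_ofReal (ger0_norm (expR_ge0 _)).
by rewrite normCE /= cos2Dsin2 sqrtr1 mulr1.
Qed.

Lemma cexp_neq0 z : cexp z != 0.
Proof. by rewrite -normr_gt0 norm_cexp ltr_ofReal expR_gt0. Qed.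

Lemma cexpN z : cexp (- z) = (cexp z)^-1.
Proof. by rewrite -[LHS](mulKf (cexp_neq0 z)) -cexpD subrr cexp0 mulr1. Qed.

Lemma cexp_ofReal x : cexp (ofReal x) = ofReal (expR x).
Proof. by rewrite /cexp /= cos0 sin0 mulr1. Qed.

(** With [h = x + i y], the error [cexp h - 1 - h] has real part
    [(e^x - 1 - x) + e^x (cos y - 1)] and imaginary part
    [e^x (sin y - y) + (e^x - 1) y]; each of the four terms is [o(|h|)] because
    of the derivatives of the real functions [expR], [cos] and [sin] at [0]. *)
Lemma cexp_near0 (e : R) : 0 < e ->
  \forall h \near (0 : cplx R), `|cexp h - 1 - h| <= ofReal e * `|h|.
Proof.
(* The four error terms cost 1 + 2 + 2 + 1 sixths of e, as expR x <= 2. *)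
move=> e0; have e6 : 0 < e / 6 by rewrite divr_gt0.
have expR' : is_derive (0 : R) 1 expR 1.
  by apply: is_derive_eq (is_derive_expR 0) _; rewrite expR0.
have cos' : is_derive (0 : R) 1 cos 0.
  by apply: is_derive_eq (is_derive_cos 0) _; rewrite sin0 oppr0.
have sin' : is_derive (0 : R) 1 sin 1.
  by apply: is_derive_eq (is_derive_sin 0) _; rewrite cos0.
have nR (P : set R) : nbhs (0 : R) P ->
    \forall h \near (0 : cplx R), P (complex.Re h) by apply: (@continuous_Re R 0).
have nI (P : set R) : nbhs (0 : R) P ->
    \forall h \near (0 : cplx R), P (complex.Im h) by apply: (@continuous_Im R 0).
have expRc : \forall k \near (0 : R), `|expR k - 1| < e / 6.
  move: (@continuous_expR R 0) => /cvgrPdist_lt /(_ _ e6).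
  by apply: filterS => k; rewrite distrC expR0.
have expR2 : \forall k \near (0 : R), `|expR k - 1| < 1.
  move: (@continuous_expR R 0) => /cvgrPdist_lt /(_ _ ltr01).
  by apply: filterS => k; rewrite distrC expR0.
have Hx := nR _ (is_derive_near e6 expR').
have Hc := nI _ (is_derive_near e6 cos').
have Hs := nI _ (is_derive_near e6 sin').
have H2 := nR _ expR2; have He := nR _ expRc.
near=> h.
have hx : `|expR (complex.Re h) - 1 - complex.Re h| <= e / 6 * `|complex.Re h|.
  by near: h; apply: filterS Hx => h; rewrite addr0 expR0 mul1r.
have hc : `|cos (complex.Im h) - 1| <= e / 6 * `|complex.Im h|.
  by near: h; apply: filterS Hc => h; rewrite addr0 cos0 mul0r subr0.
have hs : `|sin (complex.Im h) - complex.Im h| <= e / 6 * `|complex.Im h|.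
  by near: h; apply: filterS Hs => h; rewrite addr0 sin0 subr0 mul1r.
have h2 : `|expR (complex.Re h) - 1| < 1 by near: h; exact: H2.
have he : `|expR (complex.Re h) - 1| < e / 6 by near: h; exact: He.
have xh := Re_norm_le h; have yh := Im_norm_le h.
have -> : cexp h - 1 - h =
    ofReal (expR (complex.Re h) * cos (complex.Im h) - 1 - complex.Re h) +
    Complex 0 1 *
    ofReal (expR (complex.Re h) * sin (complex.Im h) - complex.Im h).
  rewrite /cexp /ofReal; case: (h) => x y; apply/eqP; rewrite eq_complex /=.
  by apply/andP; split; apply/eqP; ring.
apply: (le_trans (ler_normD _ _)).
rewrite normrM norm_i mul1r !norm_ofReal -ofRealD.
move: xh yh; rewrite [`|h|]normCE -ofRealM !ler_ofReal; set N := Num.sqrt _.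
move: hx hc hs h2 he; set x := complex.Re h; set y := complex.Im h.
set E := expR x => hx hc hs h2 he xN yN.
have E2 : 0 <= E <= 2.
  by rewrite expR_ge0 /=; move: h2; rewrite ltr_norml => /andP[_]; lra.
have A : `|E * cos y - 1 - x| <= e / 6 * `|x| + 2 * (e / 6 * `|y|).
  have -> : E * cos y - 1 - x = (E - 1 - x) + E * (cos y - 1) by ring.
  apply: (le_trans (ler_normD _ _)); apply: lerD => //.
  case/andP: E2 => E0 E2.
  by rewrite normrM (ger0_norm E0) ler_pM.
have B : `|E * sin y - y| <= 2 * (e / 6 * `|y|) + e / 6 * `|y|.
  have -> : E * sin y - y = E * (sin y - y) + (E - 1) * y by ring.
  apply: (le_trans (ler_normD _ _)); apply: lerD.
    case/andP: E2 => E0 E2.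
    by rewrite normrM (ger0_norm E0) ler_pM.
  by rewrite normrM ler_wpM2r// ltW.
have ex : e * `|x| <= e * N by rewrite ler_pM2l.
have ey : e * `|y| <= e * N by rewrite ler_pM2l.
by lra.
Unshelve. all: by end_near. Qed.

Lemma is_derive_cexp t : is_derive t 1 cexp (cexp t).
Proof.
apply: near_is_derive => e /pos_ofReal[d d0 ->].
have e0 : 0 < expR (complex.Re t) by exact: expR_gt0.
have := cexp_near0 (divr_gt0 d0 e0); apply: filterS => k Hk.
have -> : cexp (k + t) - cexp t - cexp t * k = cexp t * (cexp k - 1 - k).
  by rewrite cexpD; ring.
rewrite normrM norm_cexp.
have := ler_wpM2l (_ : 0 <= ofReal (expR (complex.Re t))) Hk.
rewrite ofRealM ofRealV mulrA mulrCA divff ?ofReal_eq0 ?gt_eqF// mulr1.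
by apply; rewrite -ofReal0 ler_ofReal ltW.
Qed.

(** The real and imaginary parts of a function of a complex variable,
    restricted to a line, are functions to which the mean value theorem
    applies. *)
Lemma is_derive_Re_line (f : cplx R -> cplx R) (a v d : cplx R) (s : R) :
    is_derive (a + v * ofReal s) 1 f d ->
  is_derive s 1 (fun s => complex.Re (f (a + v * ofReal s))) (complex.Re (v * d)).
Proof.
move=> fd; apply: near_is_derive => e e0.
have v1 : 0 < 1 + `|v| by rewrite ltr_pwDl.
have e1 : 0 < ofReal e / (1 + `|v|) by rewrite divr_gt0// ltr_ofReal.
have F0 : Filter (nbhs (0 : R)) by exact: nbhs_filter.
have line : (fun k : R => v * ofReal k) @ nbhs (0 : R) --> (0 : cplx R).
  have c1 : cst v @ nbhs (0 : R) --> v by exact: (@cvg_cst _ _ _ _ F0).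
  have := @cvgM _ _ _ F0 (cst v) ofReal v (ofReal 0) c1 (@continuous_ofReal R 0).
  by rewrite ofReal0 mulr0.
have /line := is_derive_near e1 fd; apply: (@filterS _ _ F0) => k /=.
rewrite addrCA [X in f X](_ : _ = a + v * ofReal (k + s)); last first.
  by rewrite ofRealD; ring.
set D := _ - _ - d * _ => HD.
have -> : complex.Re (f (a + v * ofReal (k + s))) -
    complex.Re (f (a + v * ofReal s)) - complex.Re (v * d) * k = complex.Re D.
  by rewrite -ReM_ofReal -!ReN -!ReD [v * d * _]mulrAC [_ * d]mulrC.
rewrite -ler_ofReal; apply: (le_trans (Re_norm_le D)); apply: (le_trans HD).
rewrite normrM norm_ofReal ofRealM mulrA ler_wpM2r//.
  by rewrite -ofReal0 ler_ofReal.
rewrite mulrAC ler_pdivrMr// ler_wpM2l//; last by rewrite lerDr.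
by rewrite -ofReal0 ler_ofReal ltW.
Qed.

(** Only the points of the segment matter, which allows an application to
    quotients that are undefined elsewhere. *)
Lemma derive0_segment (f : cplx R -> cplx R) (a v : cplx R) :
    (forall s : R, 0 <= s <= 1 -> is_derive (a + v * ofReal s) 1 f 0) ->
  f (a + v) = f a.
Proof.
suff Re_cst (g : cplx R -> cplx R) : (forall s : R, 0 <= s <= 1 -> is_derive (a + v * ofReal s) 1 g 0) ->
    complex.Re (g (a + v)) = complex.Re (g a).
  move=> fd; have fR := Re_cst _ fd.
  (* The imaginary part of f is the real part of - i f. *)
  have fI : complex.Re (- Complex 0 1 * f (a + v)) =
            complex.Re (- Complex 0 1 * f a).
    apply: (Re_cst (fun z => - Complex 0 1 * f z)) => s /fd fs.
    have := @is_deriveZ _ _ _ f (- Complex 0 1) _ _ _ fs.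
    by rewrite scaler0.
  have ReNi z : complex.Re (- Complex 0 1 * z) = complex.Im z.
    by case: z => x y /=; ring.
  by rewrite (cplxE (f (a + v))) -!ReNi fR fI !ReNi -cplxE.
move=> gd.
have gs (s : R) : 0 <= s <= 1 ->
    is_derive s 1 (fun s => complex.Re (g (a + v * ofReal s))) 0.
  by move=> /gd /is_derive_Re_line; rewrite mulr0.
have gc : {within `[(0 : R), 1], continuous (fun s => complex.Re (g (a + v * ofReal s)))}.
  by apply: derivable_within_continuous => s /[!in_itv]/= /gs [].
have gs' (s : R) : s \in `]0, 1[ ->
    is_derive s 1 (fun s => complex.Re (g (a + v * ofReal s))) 0.
  by rewrite in_itv /= => /andP[s0 s1]; apply: gs; rewrite !ltW.
have [c _] := MVT_segment ler01 gs' gc.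
by rewrite mul0r ofReal1 ofReal0 mulr1 mulr0 addr0 => /eqP; rewrite subr_eq0 => /eqP.
Qed.

End ComplexExponential.

(** * Wronskians and recessive solutions *)

Section Solutions.
Context {R : realType} {m : nat}.
Implicit Types (f g h : cplx R -> cplx R) (a : 'rV[cplx R]_m) (t : cplx R).

Lemma is_derive_Dx f t : derivable f t 1 -> is_derive t 1 f (cexp t * Dx f t).
Proof.
move=> fd; apply: is_derive_eq (derivableP fd) _.
by rewrite /Dx derive1E mulrCA divff ?cexp_neq0// mulr1.
Qed.

Lemma Dx_is_derive f t d : is_derive t 1 f d -> Dx f t = d / cexp t.
Proof. by move=> fd; rewrite /Dx derive1E derive_val. Qed.

Lemma is_derive_translate f (L t d : cplx R) :
  is_derive (t + L) 1 f d -> is_derive t 1 (fun z => f (z + L)) d.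
Proof.
move=> fd; apply: near_is_derive => e e0.
by have := is_derive_near e0 fd; apply: filterS => k; rewrite addrA.
Qed.

(** The Wronskian with respect to [x], not to the logarithm [t]. *)
Definition wronskian f g t : cplx R := f t * Dx g t - Dx f t * g t.

Fact abel (f g p q e v : cplx R) :
  e * p * q + f * (e * (v * g)) - (e * (v * f) * g + p * (e * q)) = 0.
Proof. by ring. Qed.

Fact cramer (f g h p q r : cplx R) :
  (f * q - p * g) * h = (h * q - r * g) * f + (f * r - p * h) * g.
Proof. by ring. Qed.

Fact quotient_rule (f g p q e : cplx R) : g != 0 -> f * q - p * g = 0 ->
  e * p * g^-1 + f * (- (e * q) / g ^+ 2) = 0.
Proof.
move=> g0 W0.
have -> : e * p * g^-1 + f * (- (e * q) / g ^+ 2) = - e * (f * q - p * g) / g ^+ 2.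
  by field.
by rewrite W0 mulr0 mul0r.
Qed.

(** Abel's identity: the equation has no first-order term, so that the Wronskian
    does not vary with [x]. *)
Lemma is_derive_wronskian a f g t : is_solution a f -> is_solution a g ->
  is_derive t 1 (wronskian f g) 0.
Proof.
move=> [f1 f2 fE] [g1 g2 gE].
set V := (Pm a).[cexp t] / cexp t ^+ 2.
have df : is_derive t 1 (Dx f) (cexp t * (V * f t)).
  exact: is_derive_eq (is_derive_Dx (f2 t)) (congr1 ( *%R (cexp t)) (fE t)).
have dg : is_derive t 1 (Dx g) (cexp t * (V * g t)).
  exact: is_derive_eq (is_derive_Dx (g2 t)) (congr1 ( *%R (cexp t)) (gE t)).
have H := is_derive_sub (is_derive_mul (is_derive_Dx (f1 t)) dg)
  (is_derive_mul df (is_derive_Dx (g1 t))).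
apply: is_derive_eq H (abel _ _ _ _ _ _).
Qed.

Lemma wronskian_cst a f g : is_solution a f -> is_solution a g ->
  forall t, wronskian f g t = wronskian f g 0.
Proof.
move=> fs gs t; rewrite -[t in LHS](add0r t).
by apply: derive0_segment => s _; exact: is_derive_wronskian fs gs.
Qed.

(** Cramer's rule: the coordinates of [h] are quotients of constant
    Wronskians, so that no uniqueness theorem for the equation is needed. *)
Lemma wronskian_span a f g h :
    is_solution a f -> is_solution a g -> is_solution a h ->
    wronskian f g 0 != 0 ->
  exists c d : cplx R, forall t, h t = c * f t + d * g t.
Proof.
move=> fs gs hs W0.
exists (wronskian h g 0 / wronskian f g 0), (wronskian f h 0 / wronskian f g 0).
move=> t; apply: (mulfI W0); rewrite mulrDr !mulrA.
rewrite ![wronskian f g 0 * _ / _]mulrAC divff// !mul1r.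
rewrite -(wronskian_cst fs gs t) -(wronskian_cst hs gs t).
by rewrite -(wronskian_cst fs hs t); exact: cramer.
Qed.

Section RecessivePair.
Variables (a : 'rV[cplx R]_m) (f g : cplx R -> cplx R).
Hypotheses (fs : is_solution a f) (gs : is_solution a g).
Hypothesis f_neq0 : \forall x \near +oo%R, f (ofReal x) != 0.
Hypothesis g_neq0 : \forall x \near +oo%R, g (ofReal x) != 0.
Hypothesis fg0 : f (ofReal x) / g (ofReal x) @[x --> +oo%R] --> (0 : cplx R).

(** If the Wronskian vanished, [f / g] would be constant far out on the real
    axis, hence equal to its limit [0]. *)
Lemma recessive_wronskian_neq0 : wronskian f g 0 != 0.
Proof.
apply/eqP => W0.
have [M [_ HM]] : \forall x \near +oo%R, f (ofReal x) != 0 /\ g (ofReal x) != 0.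
  by near=> x; split; near: x.
pose x0 := M + 1.
have nz x : x0 <= x -> f (ofReal x) != 0 /\ g (ofReal x) != 0.
  by move=> x0x; apply: HM; rewrite (lt_le_trans _ x0x)// ltrDl.
have quot x : x0 <= x -> f (ofReal x) / g (ofReal x) = f (ofReal x0) / g (ofReal x0).
  move=> x0x.
  have -> : ofReal x = ofReal x0 + ofReal (x - x0) by rewrite -ofRealD addrC subrK.
  apply: (derive0_segment (f := fun t => f t / g t)) => s /andP[s0 s1].
  rewrite -ofRealM -ofRealD; set z := ofReal _.
  have gz : g z != 0.
    apply: (proj2 (nz _ _)); rewrite lerDl mulr_ge0// subr_ge0//.
  have Wz : wronskian f g z = 0 by rewrite (wronskian_cst fs gs).
  case: (fs) => f1 _ _; case: (gs) => g1 _ _.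
  have H := is_derive_mul (is_derive_Dx (f1 z)) (is_derive_inv gz (is_derive_Dx (g1 z))).
  apply: is_derive_eq H _; exact: quotient_rule.
have /eqP : f (ofReal x0) / g (ofReal x0) = 0.
  apply: (@norm_cvg_unique _ (cplx R : pseudoMetricNormedZmodType _)
    ((fun x => f (ofReal x) / g (ofReal x)) @ +oo%R) _ _ _ _ fg0).
  apply: cvg_near_cst.
  by exists x0; split=> [|x /ltW/quot]; first exact: num_real.
have [f0 g0] := nz _ (lexx x0).
by rewrite mulf_eq0 invr_eq0 (negPf f0) (negPf g0).
Unshelve. all: by end_near. Qed.

Lemma recessive_fundamental : fundamental_system a f g.
Proof.
split=> //; last first.
  by move=> h hs; exact: (wronskian_span fs gs hs recessive_wronskian_neq0).
(* Dividing c f + d g = 0 by g and letting x tend to infinity leaves d = 0. *)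
move=> c d cd0.
have d0 : d = 0.
  have lim1 : (- c) * (f (ofReal x) / g (ofReal x)) @[x --> +oo%R] --> (- c * 0 : cplx R).
    exact: cvgMr fg0.
  have lim2 : (- c) * (f (ofReal x) / g (ofReal x)) @[x --> +oo%R] --> d.
    apply: cvg_near_cst; near=> x.
    have gx : g (ofReal x) != 0 by near: x.
    by rewrite mulrA; apply: (canLR (mulfK gx)); rewrite mulNr -[LHS]add0r -(cd0 (ofReal x)); ring.
  rewrite -(mulr0 (- c)).
  exact: (@norm_cvg_unique _ (cplx R : pseudoMetricNormedZmodType _) _ _ _ _ lim2 lim1).
split=> //.
have [x fx] : exists x, f (ofReal x) != 0.
  have [M [_ HM]] := f_neq0.
  by exists (M + 1); apply: HM; rewrite ltrDl.
have := cd0 (ofReal x).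
by rewrite d0 mul0r addr0 => /eqP; rewrite mulf_eq0 (negPf fx) orbF => /eqP.
Unshelve. all: by end_near. Qed.

End RecessivePair.

End Solutions.

(** * Homogeneity and rotation by roots of unity *)

Fact rescale (K : fieldType) (d e l : K) : e != 0 -> e * l * d / e = l * d.
Proof. by move=> e0; field. Qed.

Fact rescale2 (K : fieldType) (e l p f : K) : e != 0 -> l != 0 ->
  l * (l * e * (p / (l * e) ^+ 2 * f)) / e = p / e ^+ 2 * f.
Proof. by move=> e0 l0; field; rewrite e0 l0. Qed.

Section Homogeneity.
Context {R : realType} {m : nat}.
Implicit Types (a : 'rV[cplx R]_m) (l L t : cplx R).

Lemma dilate_dilate l l' a : dilate l (dilate l' a) = dilate (l * l') a.
Proof. by apply/rowP => i; rewrite !mxE mulrA exprMn. Qed.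

Lemma dilate1 a : dilate 1 a = a.
Proof. by apply/rowP => i; rewrite !mxE expr1n mul1r. Qed.

Lemma horner_Pm_dilate l a (x : cplx R) :
  (Pm (dilate l a)).[l * x] = l ^+ m * (Pm a).[x].
Proof.
rewrite /Pm !hornerE !horner_sum mulrDr exprMn; congr (_ + _).
rewrite mulr_sumr; apply: eq_bigr => i _.
rewrite !hornerE mxE exprMn mulrACA -exprD.
by rewrite subnKC// !mulrA.
Qed.

Lemma coef_Pm_dilate l a k : (k <= m)%N ->
  (Pm (dilate l a))`_(m - k) = l ^+ k * (Pm a)`_(m - k).
Proof.
move=> km; rewrite /Pm !coefD !coef_sum !coefXn mulrDr; congr (_ + _).
  have [->|k0] := eqVneq k 0%N; first by rewrite expr0 mul1r.
  by rewrite (_ : (m - k == m)%N = false) ?mulr0//; apply/negbTE; lia.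
rewrite mulr_sumr; apply: eq_bigr => i _; rewrite !coefZ !coefXn mxE.
have [ik|ik] := eqVneq (m - k)%N (m - i.+1)%N; last by rewrite !mulr0.
rewrite !mulr1 (_ : k = i.+1)//.
by have := ltn_ord i; lia.
Qed.

(** The rescaled coefficients satisfy the convolution identity that
    characterizes the square root, since [P_m] is homogeneous when [a_i] has
    weight [i]. *)
Lemma b_coef_dilate l a k : b_coef (dilate l a) k = l ^+ k * b_coef a k.
Proof.
apply/esym/(sqrt_coef_uniq (b := fun k => l ^+ k * b_coef a k)).
  by rewrite expr0 mul1r.
move=> {}k.
transitivity (l ^+ k * \sum_(0 <= i < k.+1) b_coef a i * b_coef a (k - i)%N).
  rewrite mulr_sumr; apply: eq_big_nat => i /andP[_ ik].
  by rewrite mulrACA -exprD subnKC.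
rewrite sqrt_coef_sqr; last first.
  rewrite leq0n subn0 /Pm coefD coefXn eqxx coef_sum big1 ?addr0// => i _.
  rewrite coefZ coefXn (_ : (m == m - i.+1)%N = false) ?mulr0//.
  by apply/negbTE; have := ltn_ord i; lia.
by case: ifP => km; rewrite ?mulr0// coef_Pm_dilate.
Qed.

(** [L] is a logarithm of [omega] or of [omega^-1]; the identity
    [omega^(m/2) = -1] exchanges the two exponential behaviours. *)
Lemma S_fun_rotate L t a : cexp (m%:R / 2 * L) = -1 ->
  S_fun (t + L) (dilate (cexp L) a) = - S_fun t a.
Proof.
move=> Lm; rewrite /S_fun opprD; congr (_ + _).
  by rewrite /cover_pow mulrDr cexpD Lm mulrN1 mulrN.
rewrite -sumrN; apply: eq_bigr => k _.
rewrite b_coef_dilate /cover_pow mulrDr cexpD.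
have -> : cexp ((m%:R / 2 - k%:R) * L) = - cexp L ^- k.
  by rewrite mulrBl cexpD Lm mulN1r cexpN mulr_natl cexpMn.
rewrite !mulrN; congr (- _).
have Lk : cexp L ^+ k != 0 by rewrite expf_neq0// cexp_neq0.
by move: (cexp L ^+ k) (b_coef a k) (_ - _)^-1 (cexp _) Lk => x y z w Lk; field.
Qed.

(** For odd [m] the exponent [r] is constant, equal to [(1 - m / 2) / 2]; for even [m]
    the coefficient [b_0] has weight [m / 2] and changes sign. *)
Lemma r_exp_rotate L a : cexp (m%:R / 2 * L) = -1 ->
  r_exp (dilate (cexp L) a) = 1 - m%:R / 2 - r_exp a.
Proof.
move=> Lm; rewrite /r_exp; case: ifPn => om; first by field.
have mE : m%:R = m./2%:R * 2 :> cplx R by rewrite -natrM muln2 even_halfK.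
have Lm2 : cexp L ^+ m./2 = -1.
  by rewrite -cexpMn -mulr_natl -Lm mE mulfK// pnatr_eq0.
by rewrite b_coef_dilate Lm2; move: (b_coef a _) => b; field.
Qed.

(** In the variable [x], [P_m(omega.a, omega x) = P_m(a, x)] as [omega^m = 1],
    and the operator [x^2 (d/dx)^2] is invariant under dilation. *)
Lemma is_solution_rotate L a f : cexp L ^+ m = 1 ->
  is_solution (dilate (cexp L) a) f -> is_solution a (fun t => f (t + L)).
Proof.
move=> Lm [f1 f2 fE].
have D1 : Dx (fun t => f (t + L)) = fun t => cexp L * Dx f (t + L).
  apply/funext => t.
  rewrite (Dx_is_derive (is_derive_translate (is_derive_Dx (f1 _)))) cexpD.
  exact: rescale (cexp_neq0 t).
have d2 t : is_derive t 1 (Dx (fun t => f (t + L)))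
    (cexp L * (cexp (t + L) * Dx (Dx f) (t + L))).
  rewrite D1; apply: is_derive_eq (is_derive_mul (is_derive_cst (cexp L) t 1)
    (is_derive_translate (is_derive_Dx (f2 _)))) _.
  by rewrite mul0r add0r.
split.
- by move=> t; have [] := is_derive_translate (is_derive_Dx (f1 (t + L))).
- by move=> t; have [] := d2 t.
move=> t; rewrite (Dx_is_derive (d2 t)) fE.
have -> : cexp (t + L) = cexp L * cexp t by rewrite cexpD mulrC.
rewrite horner_Pm_dilate Lm mul1r.
exact: rescale2 (cexp_neq0 _) (cexp_neq0 _).
Qed.

End Homogeneity.

Section Omega.
Context {R : realType} (s : bool) (m : nat).
Hypothesis m_gt0 : (0 < m)%N.
Notation lg := (@omega_log R s m).
Notation omega := (@omega_pow R s m).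

Lemma omega_logD (c d : cplx R) : lg (c + d) = lg c + lg d.
Proof. by rewrite /omega_log; ring. Qed.

Lemma omega_logN (c : cplx R) : lg (- c) = - lg c.
Proof. by rewrite /omega_log; ring. Qed.

Lemma omega_powD (c d : cplx R) : omega (c + d) = omega c * omega d.
Proof. by rewrite /omega_pow omega_logD cexpD. Qed.

Let m_neq0 : m%:R != 0 :> cplx R. Proof. by rewrite pnatr_eq0 -lt0n. Qed.

Lemma omega_half (c : cplx R) : m%:R / 2 * lg c = lg (m%:R / 2 * c).
Proof. by rewrite /omega_log; field. Qed.

Lemma omega_pow_half : omega (m%:R / 2) = -1.
Proof.
rewrite /omega_pow /omega_log (_ : _ * _ = (-1) ^+ s * Complex 0 pi); last first.
  have -> : Complex 0 (2 * pi) = 2 * Complex 0 pi :> cplx R.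
    by apply/eqP; rewrite eq_complex /=; apply/andP; split; apply/eqP; ring.
  by field.
have pi1 : cexp (Complex 0 pi) = -1 :> cplx R.
  rewrite /cexp /= expR0 cospi sinpi ofReal1 mul1r.
  by apply/eqP; rewrite eq_complex /= oppr0 !eqxx.
by case: s; rewrite ?expr1 ?expr0 ?mul1r// mulN1r cexpN pi1 invrN1.
Qed.

Lemma omega_pow_m : omega m%:R = 1.
Proof.
rewrite [m%:R](_ : _ = m%:R / 2 + m%:R / 2); last by field.
by rewrite omega_powD omega_pow_half mulrNN mulr1.
Qed.

Lemma omega_powX (c : cplx R) n : omega c ^+ n = omega (n%:R * c).
Proof.
by rewrite /omega_pow -cexpMn /omega_log -mulr_natl; congr cexp; ring.
Qed.

Lemma omega_pow_intm (k : int) : omega (k%:~R * m%:R) = 1.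
Proof.
have nat_case n : omega (n%:R * m%:R) = 1 by rewrite -omega_powX omega_pow_m expr1n.
case: k => n; first by rewrite -pmulrn.
rewrite NegzE mulrNz mulNr /omega_pow omega_logN cexpN.
by rewrite -/(omega_pow _ _ _) -pmulrn nat_case invr1.
Qed.

Lemma omega_pow_int_root (k : int) : omega k%:~R ^+ m = 1.
Proof. by rewrite omega_powX mulrC omega_pow_intm. Qed.

Lemma omega_pow_modz (k : int) : omega (k %% m)%Z%:~R = omega k%:~R.
Proof.
have kE : k%:~R = (k %/ m)%Z%:~R * m%:R + (k %% m)%Z%:~R :> cplx R.
  by rewrite {1}(divz_eq k m) [LHS]intrD [X in X + _ = _]intrM.
by rewrite [k%:~R in RHS]kE omega_powD omega_pow_intm mul1r.
Qed.

End Omega.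

(** * Asymptotics on the positive real axis *)

Section Ray.
Context {R : realType} {m : nat}.
Hypothesis m_gt0 : (0 < m)%N.
Implicit Types (a : 'rV[cplx R]_m) (c L t : cplx R) (x : R).

Let m_pos : 0 < m%:R :> R. Proof. by rewrite ltr0n. Qed.

Lemma norm_cplx_real (z : cplx R) : exists2 r : R, 0 <= r & `|z| = ofReal r.
Proof.
exists (complex.Re `|z|); last by rewrite /ofReal RRe_real// normr_real.
by have := normr_ge0 z; rewrite lecE => /andP[].
Qed.

Lemma cover_pow_ray x (q : R) : cover_pow (ofReal x) (ofReal q) = ofReal (expR (q * x)).
Proof. by rewrite /cover_pow -ofRealM cexp_ofReal. Qed.

(** On the real axis [2 S] is [(4/m) e^(m x / 2)] up to an error that is smaller by
    a factor [e^(x/4)]: the remaining terms of [S] have exponents at most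
    [(m/2 - 1) x], and [x <= 4 e^(x/4)] with [1/4 <= m/2 - 1/4]. *)
Lemma S_fun_ray c a : exists M : R, forall x, 0 <= x ->
  `|c * ofReal x - 2 * S_fun (ofReal x) a + ofReal (4 / m%:R * expR (m%:R / 2 * x))|
    <= ofReal (M * expR ((m%:R / 2 - 4^-1) * x)).
Proof.
have m1 : 1 <= m%:R :> R by rewrite ler1n.
pose co k := `|b_coef a k / (m%:R / 2 - k%:R)|.
have [N N0 NE] := norm_cplx_real (\sum_(1 <= k < m | (k.*2 < m)%N) co k).
rewrite ger0_norm in NE; last by apply: sumr_ge0 => k _; exact: normr_ge0.
have [r r0 rE] := norm_cplx_real c.
exists (4 * r + 2 * N) => x x0; set W := expR ((_ - _) * x).
have xW : x <= 4 * W.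
  have : 1 + x / 4 <= W.
    apply: (le_trans (expR_ge1Dx _)).
    by rewrite ler_expR; nra.
  lra.
have -> : c * ofReal x - 2 * S_fun (ofReal x) a +
    ofReal (4 / m%:R * expR (m%:R / 2 * x)) =
    c * ofReal x - 2 * \sum_(1 <= k < m | (k.*2 < m)%N)
      b_coef a k / (m%:R / 2 - k%:R) * cover_pow (ofReal x) (m%:R / 2 - k%:R).
  rewrite /S_fun (_ : cover_pow _ (m%:R / 2) = ofReal (expR (m%:R / 2 * x))).
    by rewrite ofRealM ofRealM ofRealV !ofReal_nat; ring.
  by rewrite -cover_pow_ray ofRealM ofRealV !ofReal_nat.
apply: (le_trans (ler_normB _ _)).
rewrite [(_ + _) * W]mulrDl ofRealD; apply: lerD.
  rewrite normrM rE norm_ofReal ger0_norm// -ofRealM ler_ofReal.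
  by rewrite -mulrA mulrCA ler_wpM2l.
rewrite normrM normr_nat -mulrA ofRealM ofReal_nat ler_wpM2l// ofRealM -NE.
rewrite mulr_suml.
apply: (le_trans (ler_norm_sum _ _ _)).
rewrite [leLHS]big_nat_cond [leRHS]big_nat_cond; apply: ler_sum => k /andP[/andP[k1 _] _].
rewrite normrM ler_wpM2l//.
have -> : m%:R / 2 - k%:R = ofReal (m%:R / 2 - k%:R : R) :> cplx R.
  by rewrite ofRealB ofRealM ofRealV !ofReal_nat.
rewrite cover_pow_ray norm_ofReal ler_ofReal ger0_norm ?expR_ge0//.
have k1' : 1 <= k%:R :> R by rewrite ler1n.
by rewrite ler_expR; nra.
Qed.

(** The square of the recessive exponential [e^(-S)] beats every power of
    [cexp x]. *)
Lemma cvg_cexp_ray0 c a :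
  cexp (c * ofReal x - 2 * S_fun (ofReal x) a) @[x --> +oo%R] --> (0 : cplx R).
Proof.
have [M HM] := S_fun_ray c a.
apply: (proj2 (@cvgrPdist_lt _ (cplx R) _ (+oo%R) _ _ _)) => e /pos_ofReal[d d0 ->].
have d1 : 0 < d^-1 by rewrite invr_gt0.
near=> x.
have x0 : 0 <= x by near: x; apply: nbhs_pinfty_ge; rewrite num_real.
have xM : m%:R * (M + d^-1) <= x.
  by near: x; apply: nbhs_pinfty_ge; rewrite num_real.
rewrite sub0r normrN norm_cexp ltr_ofReal.
have {HM} := HM x x0; set Z := _ - _; set W := expR ((_ - _) * x) => HZ.
have m1 : 1 <= m%:R :> R by rewrite ler1n.
have W1 : 1 <= W by rewrite -expR0 ler_expR; nra.
have vE : expR (m%:R / 2 * x) = W * expR (x / 4).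
  by rewrite -expRD; congr expR; field.
have ReZ : complex.Re Z <= - d^-1.
  have := le_trans (Re_norm_le _) HZ; rewrite ler_ofReal ReD /= => H.
  have {}H := le_trans (ler_norm _) H.
  have v1 : 1 + x / 4 <= expR (x / 4) by exact: expR_ge1Dx.
  have H2 : M + d^-1 <= 4 / m%:R * expR (x / 4).
    rewrite mulrAC ler_pdivlMr// mulrC; apply: (le_trans xM); lra.
  have : complex.Re Z <= W * (M - 4 / m%:R * expR (x / 4)).
    by move: H; rewrite vE; lra.
  move=> /le_trans; apply; nra.
apply: (@le_lt_trans _ _ (expR (- d^-1))); first by rewrite ler_expR.
rewrite expRN invf_plt ?posrE ?expR_gt0//.
by apply: lt_le_trans (expR_ge1Dx _); rewrite ltrDr.
Unshelve. all: by end_near. Qed.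

(** The leading asymptotic behaviour [x^r e^(-S)] of [Phi_0]. *)
Definition profile a t : cplx R := cover_pow t (r_exp a) * cexp (- S_fun t a).

Lemma profile_neq0 a t : profile a t != 0.
Proof. by rewrite mulf_neq0 ?cexp_neq0. Qed.

Lemma profile_rotate L a t : cexp (m%:R / 2 * L) = -1 ->
  profile (dilate (cexp L) a) (t + L) =
  cexp ((1 - m%:R / 2 - r_exp a) * L) *
  cexp ((1 - m%:R / 2 - r_exp a) * t + S_fun t a).
Proof.
move=> Lm; rewrite /profile S_fun_rotate// r_exp_rotate// opprK /cover_pow.
rewrite -!cexpD; congr cexp.
by move: (S_fun t a) (_ - r_exp a) => ? ?; ring.
Qed.

(** Rotation turns [e^(-S)] into [e^S], so the rotated profile dominates. *)
Lemma cvg_profile0 L a : cexp (m%:R / 2 * L) = -1 ->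
  profile a (ofReal x) / profile (dilate (cexp L) a) (ofReal x + L)
    @[x --> +oo%R] --> (0 : cplx R).
Proof.
move=> Lm; set q := 1 - m%:R / 2 - r_exp a.
rewrite (_ : (fun x => _) = fun x => cexp (- (q * L)) *
    cexp ((r_exp a - q) * ofReal x - 2 * S_fun (ofReal x) a)).
  rewrite -(mulr0 (cexp (- (q * L)))); exact: cvgMr (cvg_cexp_ray0 _ _).
apply/funext => x; rewrite profile_rotate// -/q /profile /cover_pow.
rewrite -!cexpD -cexpN -!cexpD; congr cexp.
by move: (r_exp a) (S_fun _ _) q => ? ? ?; ring.
Qed.

Variables (Phi0 : cplx R -> 'rV[cplx R]_m -> cplx R).
Hypothesis hPhi0 : is_Phi0 Phi0.

(** The bound on the argument is chosen so that one application of the asymptotic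
    expansion, in a strict sub-sector of the sector of half-opening [3 pi / m],
    covers [Phi_0], [Phi_1] and [Phi_{-1}] on the real axis. *)
Lemma cvg_Phi0_profile a (y : R) : `|y| <= 2 * pi / m%:R ->
  Phi0 (ofReal x + Complex 0 y) a / profile a (ofReal x + Complex 0 y)
    @[x --> +oo%R] --> (1 : cplx R).
Proof.
rewrite ler_norml => ym.
have [c [c0 _ ca]] := Phi0_asymptotic hPhi0.
have pim : 0 < pi / m%:R :> R by rewrite divr_gt0// pi_gt0.
have lo : - (3 * pi / m%:R) < - (2 * pi / m%:R) :> R by rewrite ltrN2 -!mulrA; lra.
have hi : 2 * pi / m%:R < 3 * pi / m%:R :> R by rewrite -!mulrA; lra.
(* The expansion is used to its first term only. *)
have [K [rho /nbhs_singleton H]] := ca _ _ 1%N a lo hi.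
apply: (proj2 (@cvgrPdist_lt _ (cplx R) _ (+oo%R) _ _ _)) => e /pos_ofReal[d d0 ->].
near=> x.
have xK : 2 * (`|K| / d) <= x.
  by near: x; apply: nbhs_pinfty_ge; rewrite num_real.
have xrho : rho <= x by near: x; apply: nbhs_pinfty_ge; rewrite num_real.
have argE : arg (ofReal x + Complex 0 y) = y by rewrite /arg /= add0r.
have modE : modulus (ofReal x + Complex 0 y) = expR x by rewrite /modulus /= addr0.
have := H (ofReal x + Complex 0 y).
rewrite argE modE => /(_ ym).
have xe : rho <= expR x.
  by apply: (le_trans xrho); apply: le_trans (expR_ge1Dx _); rewrite lerDr.
move=> /(_ xe); rewrite big_ord1 c0 mul1r /cover_pow mul0r oppr0 mul0r cexp0.
rewrite distrC => /le_lt_trans; apply; rewrite ltr_ofReal.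
have -> : expR x `^ (- (1 / 2)) = (expR (x / 2))^-1.
  by rewrite -expRN /powR gt_eqF ?expR_gt0// expRK; congr expR; field.
apply: (le_lt_trans (ler_wpM2r _ (ler_norm K))); first by rewrite invr_ge0 expR_ge0.
rewrite ltr_pdivrMr ?expR_gt0// mulrC -ltr_pdivrMr//.
apply: lt_le_trans (expR_ge1Dx _); lra.
Unshelve. all: by end_near. Qed.

End Ray.

(** * Dependence on the parameters *)

Section Differentiability.
Context {K : numFieldType}.

(** The differential is determined by the first-order expansion at [x], and this
    expansion only sees the values near [x]. *)
Lemma near_eq_differentiable (V W : normedModType K) (f g : V -> W) (x : V) :
  {near x, f =1 g} -> differentiable f x -> differentiable g x.
Proof.
move=> fg fd; have gx : g x = f x by have := nbhs_singleton fg.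
have gd : g \o shift x = cst (g x) + 'd f x +o_ 0 id.
  rewrite gx; apply/eqaddoP => e e0.
  have /eqaddoP /(_ _ e0) := diff_locally fd.
  have fg0 : \forall y \near 0, f (y + x) = g (y + x).
    have fg' : \forall y \near x, f y = g y by exact: fg.
    by move: fg'; rewrite (near_shift 0) subr0.
  apply: filterS2 fg0 => y fgy; rewrite /= => fy.
  by move: fy; rewrite !fctE /= fgy.
have dc : continuous ('d f x) by exact: diff_continuous.
by apply/diff_locallyP; rewrite (diff_unique dc gd).
Qed.

Lemma differentiable_bigsum (V W : normedModType K) (I : Type) (r : seq I)
    (P : pred I) (F : I -> V -> W) (x : V) :
  (forall i, P i -> differentiable (F i) x) ->
  differentiable (fun z => \sum_(i <- r | P i) F i z) x.
Proof.
move=> Fd; rewrite -fct_sumE; elim/big_ind: _ => //.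
by move=> f g fd gd; exact: differentiableD.
Qed.

Lemma differentiable_matrix (V : normedModType K) m n (F : V -> 'M[K]_(m, n)) (x : V) :
  (forall i j, differentiable (fun z => F z i j) x) -> differentiable F x.
Proof.
move=> Fd; rewrite (_ : F = fun z => \sum_i \sum_j F z i j *: delta_mx i j).
  apply: differentiable_bigsum => i _; apply: differentiable_bigsum => j _.
  exact: differentiableZl.
by apply/funext => z; exact: matrix_sum_delta.
Qed.

End Differentiability.

Section EntireParameters.
Context {R : realType} {m : nat}.
Implicit Types (a : 'rV[cplx R]_m).

Lemma entire_comp (U V W : normedModType (cplx R)) (f : U -> V) (g : V -> W) :
  entire f -> entire g -> entire (fun z => g (f z)).
Proof. by move=> fd gd z; apply: (differentiable_comp (fd z)); exact: gd. Qed.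

Lemma entire_dilate (l : cplx R) : entire (@dilate R m l).
Proof.
move=> a; apply: differentiable_matrix => i j.
rewrite (_ : (fun z => _) = fun z : 'rV_m => l ^+ j.+1 *: z ord0 j).
  by apply: differentiableZ; exact: differentiable_coord.
by apply/funext => z; rewrite mxE.
Qed.

Lemma entire_coef_Pm k : entire (fun a => (Pm a)`_k).
Proof.
move=> a; rewrite (_ : (fun a => _) = fun a =>
    'X^m`_k + \sum_(i < m) a ord0 i * 'X^(m - i.+1)`_k).
  apply: differentiableD; first exact: differentiable_cst.
  apply: differentiable_bigsum => i _.
  by apply: differentiableM; [exact: differentiable_coord|exact: differentiable_cst].
apply/funext => z; rewrite /Pm coefD coef_sum; congr (_ + _).
by apply: eq_bigr => i _; rewrite coefZ.
Qed.

(** The [b_k] are polynomials in the parameters, by their recursive definition. *)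
Lemma entire_b_coef k : entire (fun a => b_coef a k).
Proof.
elim/ltn_ind: k => -[_|k IH] a; first exact: differentiable_cst.
rewrite /b_coef; under eq_fun do rewrite sqrt_coefS.
apply: differentiableM; last exact: differentiable_cst.
apply: differentiableB.
  case: (k.+1 <= m)%N; last exact: differentiable_cst.
  exact: (@entire_coef_Pm (m - k.+1) a).
under eq_fun do rewrite big_nat.
apply: differentiable_bigsum => i /andP[i1 ik].
by apply: differentiableM; apply: IH; rewrite // ltn_subLR // ?addSn; lia.
Qed.

Lemma entire_r_exp : entire (@r_exp R m).
Proof.
move=> a; rewrite /r_exp; case: (odd m); first exact: differentiable_cst.
by apply: differentiableB; [exact: differentiable_cst|exact: (@entire_b_coef m./2 a)].
Qed.

Lemma entire_cexp : entire (@cexp R : cplx R -> cplx R).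
Proof. by move=> t; apply/derivable1_diffP; have [] := is_derive_cexp t. Qed.

End EntireParameters.

(** * The Stokes-Sibuya relation *)

Fact telescope_ratio (K : fieldType) (f g p q : K) : q != 0 -> p != 0 ->
  f / p * (p / q) * (g / q)^-1 = f / g.
Proof.
move=> q0 p0; have [->|g0] := eqVneq g 0; first by rewrite mul0r invr0 !mulr0.
by field; rewrite q0 p0 g0.
Qed.

Fact divide_relation (K : fieldType) (c d f g : K) : g != 0 ->
  c * (f / g) + d = (c * f + d * g) / g.
Proof. by move=> g0; rewrite mulrDl mulfK// mulrA. Qed.

Section StokesSibuya.
Context {R : realType} {m : nat} (s : bool).
Hypothesis m_gt0 : (0 < m)%N.
Variables (Phi0 : cplx R -> 'rV[cplx R]_m -> cplx R).
Hypothesis hPhi0 : is_Phi0 Phi0.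
Implicit Types (a : 'rV[cplx R]_m) (t : cplx R) (k j : int).

Notation lg k := (@omega_log R s m k%:~R).
Notation omega := (@omega_pow R s m).
Notation Phi := (Phi_ s Phi0).

(** The whole family is obtained from its members of index [-1], [0] and [1] by
    rotating the variable and the parameters; this reduces every claim about
    index [k] to index [0]. *)
Lemma Phi_shift k j t a :
  Phi (k + j) t a = Phi j (t + lg k) (dilate (omega k%:~R) a).
Proof.
rewrite /Phi_ intrD omega_logD omega_powD dilate_dilate addrA.
by rewrite [omega k%:~R * _]mulrC.
Qed.

Lemma lg0E : lg 0 = 0.
Proof. by rewrite /omega_log mulr0 mul0r mulr0. Qed.

Lemma omega_pow0 : omega 0%:~R = 1.
Proof. by rewrite /omega_pow lg0E cexp0. Qed.

Lemma entire_omega_r : entire (fun a => omega (m%:R - 2 + 2 * r_exp a)).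
Proof.
move=> a; apply: entire_comp (@entire_cexp R) _ => {}a.
rewrite /omega_log.
apply: differentiableM; first exact: differentiable_cst.
apply: differentiableM; last exact: differentiable_cst.
apply: differentiableM; first exact: differentiable_cst.
apply: differentiableD; first exact: differentiable_cst.
apply: differentiableM; first exact: differentiable_cst.
exact: entire_r_exp.
Qed.

Lemma Phi_solution k a : is_solution a (Phi k ^~ a).
Proof.
apply: is_solution_rotate (Phi0_solution hPhi0 _).
exact: omega_pow_int_root.
Qed.

Lemma Phi_entire k t : entire (Phi k t).
Proof.
exact: entire_comp (@entire_dilate _ _ _) (Phi0_entire hPhi0 (t + lg k)).
Qed.

Lemma lg1E : lg 1 = Complex 0 ((-1) ^+ s * (2 * pi / m%:R)).
Proof.
rewrite /omega_log mulr1 -[m%:R]ofReal_nat -ofRealV.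
case: s; rewrite ?expr1 ?expr0 ?mulN1r ?mul1r.
  by apply/eqP; rewrite eq_complex /=; apply/andP; split; apply/eqP; ring.
by apply/eqP; rewrite eq_complex /=; apply/andP; split; apply/eqP; ring.
Qed.

Lemma lgN1E : lg (-1) = - lg 1.
Proof. by rewrite -omega_logN -rmorphN. Qed.

Lemma lg_half : cexp (m%:R / 2 * lg 1) = -1.
Proof. by rewrite omega_half// mulr1 -(omega_pow_half s m_gt0). Qed.

Lemma lgN_half : cexp (m%:R / 2 * lg (-1)) = -1.
Proof. by rewrite lgN1E mulrN cexpN lg_half invrN1. Qed.

Lemma cvg_Phi_profile k a : k \in [:: 0; 1; -1] ->
  Phi k (ofReal x) a / profile (dilate (omega k%:~R) a) (ofReal x + lg k)
    @[x --> +oo%R] --> (1 : cplx R).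
Proof.
move=> k01.
have [y ym yE] : exists2 y : R, `|y| <= 2 * pi / m%:R & lg k = Complex 0 y.
  have pim : 0 <= 2 * pi / m%:R :> R by rewrite !mulr_ge0 ?pi_ge0 ?invr_ge0 ?ler0n.
  move: k01; rewrite !inE => /or3P[] /eqP ->.
  - by exists 0; rewrite ?normr0// lg0E.
  - exists ((-1) ^+ s * (2 * pi / m%:R)); last exact: lg1E.
    by rewrite normrM normrX normrN1 expr1n mul1r ger0_norm.
  - exists (- ((-1) ^+ s * (2 * pi / m%:R))).
      by rewrite normrN normrM normrX normrN1 expr1n mul1r ger0_norm.
    by rewrite lgN1E lg1E; apply/eqP; rewrite eq_complex /= oppr0 !eqxx.
rewrite /Phi_ yE; exact: (cvg_Phi0_profile m_gt0 hPhi0).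
Qed.

Lemma Phi_near_neq0 k a : k \in [:: 0; 1; -1] ->
  \forall x \near +oo%R, Phi k (ofReal x) a != 0.
Proof.
move=> k01; have H := cvg_Phi_profile a k01.
have /(@cvgrPdist_lt _ (cplx R) _ (+oo%R) _ _ _) /(_ 1 ltr01) := H.
apply: filterS => x; apply: contraTneq => ->.
by rewrite mul0r subr0 normr1 ltxx.
Qed.

(** [Phi_0] is recessive on the real axis, where [Phi_1] is dominant. *)
Lemma cvg_Phi01 a : Phi 0 (ofReal x) a / Phi 1 (ofReal x) a @[x --> +oo%R] --> (0 : cplx R).
Proof.
have in0 : (0 : int) \in [:: 0; 1; -1] by [].
have in1 : (1 : int) \in [:: 0; 1; -1] by [].
have c0 := cvg_Phi_profile a in0.
have c1 := cvg_Phi_profile a in1.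
have cp := cvg_profile0 m_gt0 a lg_half.
have FF : Filter (pinfty_nbhs R) by exact: _.
have c1V := @cvgV _ _ _ FF _ _ (oner_neq0 _) c1.
have := @cvgM _ _ _ FF _ _ _ _ (@cvgM _ _ _ FF _ _ _ _ c0 cp) c1V.
rewrite invr1 mulr1 mul1r; apply: cvg_trans; apply: near_eq_cvg.
have n1 := Phi_near_neq0 a in1.
apply: filterS n1 => x n1; rewrite /= /unstable.inv_fun.
rewrite lg0E addr0 omega_pow0 dilate1.
have := profile_neq0 a (ofReal x).
have := profile_neq0 (dilate (omega 1%:~R) a) (ofReal x + lg 1).
exact: telescope_ratio.
Qed.

Lemma fundamental_Phi01 a : fundamental_system a (Phi 0 ^~ a) (Phi 1 ^~ a).
Proof.
apply: recessive_fundamental; try exact: Phi_solution.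
- exact: Phi_near_neq0.
- exact: Phi_near_neq0.
- exact: cvg_Phi01.
Qed.

(** [Phi_{-1}] and [Phi_1] have the same dominant behaviour [x^q e^S] on the real
    axis, with [q = 1 - m/2 - r(a)], and the constants in front are [omega^(-q)] and
    [omega^q]; the limit is therefore [omega^(-2 q)]. *)
Lemma cvg_PhiN1 a : Phi (-1) (ofReal x) a / Phi 1 (ofReal x) a @[x --> +oo%R] -->
  omega (m%:R - 2 + 2 * r_exp a).
Proof.
have in1 : (1 : int) \in [:: 0; 1; -1] by [].
have inN1 : (-1 : int) \in [:: 0; 1; -1] by [].
have c1 := cvg_Phi_profile a in1.
have cN1 := cvg_Phi_profile a inN1.
have FF : Filter (pinfty_nbhs R) by exact: _.
have c1V := @cvgV _ _ _ FF _ _ (oner_neq0 _) c1.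
have cp : profile (dilate (omega (-1)%:~R) a) (ofReal x + lg (-1)) /
    profile (dilate (omega 1%:~R) a) (ofReal x + lg 1) @[x --> +oo%R] -->
    omega (m%:R - 2 + 2 * r_exp a).
  apply: cvg_near_cst; apply: filterE => x.
  rewrite /omega_pow (profile_rotate _ _ lgN_half) (profile_rotate _ _ lg_half).
  set q := 1 - _ - _.
  rewrite -mulf_div divff ?cexp_neq0// mulr1 -cexpN -cexpD lgN1E; congr cexp.
  by rewrite /omega_log /q; move: (r_exp a) => r; field; rewrite pnatr_eq0 -lt0n.
have := @cvgM _ _ _ FF _ _ _ _ (@cvgM _ _ _ FF _ _ _ _ cN1 cp) c1V.
rewrite invr1 mulr1 mul1r; apply: cvg_trans; apply: near_eq_cvg.
apply: filterE => x; rewrite /= /unstable.inv_fun.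
have := profile_neq0 (dilate (omega (-1)%:~R) a) (ofReal x + lg (-1)).
have := profile_neq0 (dilate (omega 1%:~R) a) (ofReal x + lg 1).
exact: telescope_ratio.
Qed.

(** Far out on the real axis [Phi_0] is negligible, so the coefficient of
    [Phi_1] is the limit of [Phi_{-1} / Phi_1]. *)
Lemma stokes_relation0 a : exists c : cplx R, forall t,
  Phi (-1) t a = c * Phi 0 t a + omega (m%:R - 2 + 2 * r_exp a) * Phi 1 t a.
Proof.
have [_ _ _ /(_ _ (Phi_solution (-1) a))[c [d cd]]] := fundamental_Phi01 a.
exists c => t; rewrite cd; congr (_ + _ * _).
have FF : Filter (pinfty_nbhs R) by exact: _.
have in1 : (1 : int) \in [:: 0; 1; -1] by [].
have lim : Phi (-1) (ofReal x) a / Phi 1 (ofReal x) a @[x --> +oo%R] --> d.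
  have cc : cst c @ pinfty_nbhs R --> c by exact: (@cvg_cst _ _ _ _ FF).
  have cd' : cst d @ pinfty_nbhs R --> d by exact: (@cvg_cst _ _ _ _ FF).
  have := @cvgD _ _ _ _ FF _ _ _ _ (@cvgM _ _ _ FF _ _ _ _ cc (cvg_Phi01 a)) cd'.
  rewrite mulr0 add0r; apply: cvg_trans; apply: near_eq_cvg.
  have n1 := Phi_near_neq0 a in1.
  apply: filterS n1 => x n1; rewrite /= cd; exact: divide_relation.
have lim' := @cvg_PhiN1 a.
exact: (@norm_cvg_unique _ (cplx R : pseudoMetricNormedZmodType _) _ _ _ _
  lim lim').
Qed.

(** Solving the relation for [C_0] at a point where [Phi_0] does not vanish
    exhibits it as a quotient of functions entire in the parameters. *)
Lemma entire_stokes0 (C0 : 'rV[cplx R]_m -> cplx R) :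
    (forall a t, Phi (-1) t a =
       C0 a * Phi 0 t a + omega (m%:R - 2 + 2 * r_exp a) * Phi 1 t a) ->
  entire C0.
Proof.
move=> C0E a0.
have [t t0] : exists t, Phi 0 t a0 != 0.
  have in0 : (0 : int) \in [:: 0; 1; -1] by [].
  have [M [_ HM]] := Phi_near_neq0 a0 in0.
  by exists (ofReal (M + 1)); apply: HM; rewrite ltrDl.
have Phi0d : differentiable (Phi 0 t) a0 by exact: Phi_entire.
apply: (near_eq_differentiable (f := fun a =>
  (Phi (-1) t a - omega (m%:R - 2 + 2 * r_exp a) * Phi 1 t a) * (Phi 0 t a)^-1)).
  have : \forall a \near a0, Phi 0 t a != 0.
    exact: cvgr_neq0 (differentiable_continuous Phi0d) t0.
  by apply: filterS => a a_neq0; rewrite C0E addrK mulfK.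
apply: differentiableM; last exact: differentiableV.
apply: differentiableB; first exact: Phi_entire.
apply: differentiableM; last exact: Phi_entire.
exact: entire_omega_r.
Qed.

Lemma fundamental_Phi k a : fundamental_system a (Phi k ^~ a) (Phi (k + 1) ^~ a).
Proof.
have PhiE j t : Phi (k + j) t a = Phi j (t + lg k) (dilate (omega k%:~R) a).
  exact: Phi_shift.
have [_ _ indep span] := fundamental_Phi01 (dilate (omega k%:~R) a).
split; try exact: Phi_solution.
- move=> c d cd; apply: indep => t.
  by rewrite -[t](subrK (lg k)) -!PhiE addr0.
move=> h hs.
have hk : is_solution (dilate (omega k%:~R) a) (fun t => h (t - lg k)).
  have root : cexp (- lg k) ^+ m = 1.
    by rewrite cexpN exprVn -[cexp _]/(omega _) omega_pow_int_root// invr1.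
  apply: (is_solution_rotate root); rewrite dilate_dilate cexpN.
  by rewrite -[cexp _]/(omega _) mulVf ?cexp_neq0// dilate1.
have [c [d cd]] := span _ hk; exists c, d => t.
by rewrite -[in LHS](addrK (lg k) t) cd -!PhiE addr0.
Qed.

End StokesSibuya.

Fact difference_relation (K : pzRingType) (c c' d d' f g : K) :
  c * f + d * g = c' * f + d' * g -> (c - c') * f + (d - d') * g = 0.
Proof. by move=> H; rewrite !mulrBl addrACA -opprD H subrr. Qed.

Theorem theorem2p7 (R : realType) (m : nat) (hm : (1 <= m)%N) (s : bool)
    (Phi0 : cplx R -> 'rV[cplx R]_m -> cplx R) (hPhi0 : is_Phi0 Phi0) :
  let Phi : int -> cplx R -> 'rV[cplx R]_m -> cplx R := Phi_ s Phi0 in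
  let omega (c : cplx R) : cplx R := omega_pow s m c in
  [/\ forall k : int,
        (forall a, analytic_on_cover (Phi k ^~ a)) /\
        (forall t, entire (Phi k t)),
      forall (k : int) a, fundamental_system a (Phi k ^~ a) (Phi (k + 1) ^~ a) &
      exists C Ct : int -> 'rV[cplx R]_m -> cplx R,
        let SS : int -> 'rV[cplx R]_m -> 'M[cplx R]_2 := stokes_matrix C Ct in
        [/\ stokes_sibuya_coefficients Phi C Ct,
            forall k : int,
              [/\ forall t a, col2 (Phi (k - 1) t a) (Phi k t a) =
                    SS k a *m col2 (Phi k t a) (Phi (k + 1) t a),
                  forall a, SS k a \in unitmx,
                  entire (SS k),
                  forall a, SS k a = SS (k - 1) (dilate (omega 1) a) &
                  forall a, SS k a = SS 0 (dilate (omega k%:~R) a)] &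
            forall k : int,
              [/\ entire (C k) /\ entire (Ct k),
                  (forall a, C k a = C 0 (dilate (omega k%:~R) a)) /\
                  (forall a, C k a = C (k %% m)%Z a),
                  (forall a, Ct k a = Ct 0 (dilate (omega k%:~R) a)),
                  (forall a, Ct 0 (dilate (omega k%:~R) a) =
                     omega (m%:R - 2 + 2 * r_exp (dilate (omega k%:~R) a))) &
                  forall a, Ct k a = Ct (k %% m)%Z a]]].
Proof.
move=> Phi omega.
have Phi_eq j k t a : Phi (k + j) t a = Phi j (t + omega_log s m k%:~R)
    (dilate (omega k%:~R) a) by exact: Phi_shift.
have [C0 C0E] := choice (stokes_relation0 s hm hPhi0).
have C0_entire := entire_stokes0 hm hPhi0 C0E.
(* The coefficients of index k are those of index 0 at the rotated parameters. *)
pose Ct0 a := omega (m%:R - 2 + 2 * r_exp (a : 'rV_m)).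
pose C (k : int) a := C0 (dilate (omega k%:~R) a).
pose Ct (k : int) a := Ct0 (dilate (omega k%:~R) a).
have relation k t a : Phi (k - 1) t a = C k a * Phi k t a + Ct k a * Phi (k + 1) t a.
  by rewrite -[in Phi k t a](addr0 k) !Phi_eq; exact: C0E.
have omega0 : omega 0%:~R = 1 by exact: omega_pow0.
have omega_pred (k : int) : omega (k - 1)%:~R * omega 1 = omega k%:~R.
  by rewrite -omega_powD intrD subrK.
have C_entire k : entire (C k) by exact: entire_comp (@entire_dilate _ _ _) C0_entire.
have Ct_entire k : entire (Ct k).
  exact: entire_comp (@entire_dilate _ _ _) (@entire_omega_r _ _ s).
split.
- move=> k; split=> [a|t]; last exact: Phi_entire.
  by have [Phi_an _ _] := Phi_solution s hm hPhi0 k a; exact: Phi_an.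
- by move=> k a; exact: fundamental_Phi.
exists C, Ct; split.
- move=> k a c ct; split=> [H|[-> ->] t]; last exact: relation.
  have [_ _ indep _] := fundamental_Phi s hm hPhi0 k a.
  have [|/eqP + /eqP] := indep (c - C k a) (ct - Ct k a).
    by move=> t; apply: difference_relation; rewrite -relation -H.
  by rewrite !subr_eq0 => /eqP-> /eqP->.
- move=> k; split.
  + move=> t a; apply/colP => i; rewrite !mxE big_ord_recl big_ord1 !mxE /=.
    by case: ifP => _; rewrite ?relation// mul1r mul0r addr0.
  (* The determinant is - Ct k a, the opposite of an exponential. *)
  + move=> a; rewrite unitmxE (expand_det_row _ ord0) big_ord_recl big_ord1.
    rewrite /cofactor !det_mx11 !mxE /= mulr0 mulr0 add0r expr1 mulr1 mulrN1.
    by rewrite unitrN unitfE cexp_neq0.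
  + move=> a; apply: differentiable_matrix => i j.
    rewrite (_ : (fun z => _) = if i == ord0 then (if j == ord0 then C k else Ct k)
      else cst (if j == ord0 then 1 else 0)); last first.
      by apply/funext => z; rewrite mxE; do 2?case: ifP.
    by case: ifP => _; [case: ifP => _; [exact: C_entire|exact: Ct_entire]|
      exact: differentiable_cst].
  + move=> a; apply/matrixP => i j; rewrite !mxE /C /Ct dilate_dilate.
    by rewrite omega_pred.
  + by move=> a; apply/matrixP => i j; rewrite !mxE /C /Ct dilate_dilate omega0 mul1r.
move=> k; split.
- by split; [exact: C_entire|exact: Ct_entire].
- split=> a; first by rewrite /C dilate_dilate omega0 mul1r.
  by rewrite /C /omega omega_pow_modz.
- by move=> a; rewrite /Ct dilate_dilate omega0 mul1r.
- by move=> a; rewrite /Ct dilate_dilate omega0 mul1r /Ct0.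
- by move=> a; rewrite /Ct /omega omega_pow_modz.
Qed.
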